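(* The following complex is a 4-periodic (free) resolution of the trivial module $\mathbb{Z}$ over $\mathbb{Z}[\mathcal{O}]$, where $\mathcal{O}$ is the binary octahedral group: $$\cdots\to \mathbb{Z}[\mathcal{O}]^3\xrightarrow{\partial_{4q-3}}\mathbb{Z}[\mathcal{O}]\xrightarrow{\partial_{4q-4}}\cdots\to\mathbb{Z}[\mathcal{O}]^3\xrightarrow{\partial_2}\mathbb{Z}[\mathcal{O}]^3\xrightarrow{\partial_1}\mathbb{Z}[\mathcal{O}]\xrightarrow{\varepsilon}\mathbb{Z}\to0,$$ whose term in degree $m\ge 0$ is $\mathbb{Z}[\mathcal{O}]$ if $m\equiv0,3\pmod 4$ and $\mathbb{Z}[\mathcal{O}]^3$ if $m\equiv1,2\pmod4$, where $\varepsilon$ is the augmentation and, for $q\ge1$, $$\partial_{4q-3}=\begin{pmatrix} \tau_i-1 \\ \tau_j-1 \\ \tau_k-1\end{pmatrix},\quad\partial_{4q-2}=\begin{pmatrix} \omega_i & \tau_k-1 & 1 \\ 1 & \omega_j & \tau_i-1 \\ \tau_j-1 & 1 & \omega_k\end{pmatrix},$$ $$\partial_{4q-1}=\begin{pmatrix} 1-\tau_i & 1-\tau_j & 1-\tau_k \end{pmatrix},\quad\partial_{4q}=\begin{pmatrix}\sum_{g\in\mathcal{O}}g\end{pmatrix}.$$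
   Context: $\mathcal{O}$ is the subgroup of order 48 of the group $\mathbb{S}^3$ of unit quaternions generated by $\frac12(-1+i+j+k)$ and $\frac{1}{\sqrt2}(1+i)$. Put $\omega_i=\frac{1-i+j+k}{2}$, $\omega_j=\frac{1+i-j+k}{2}$, $\omega_k=\frac{1+i+j-k}{2}$, $\tau_i=\frac{1+i}{\sqrt2}$, $\tau_j=\frac{1+j}{\sqrt2}$, $\tau_k=\frac{1+k}{\sqrt2}$; all lie in $\mathcal{O}$. In the matrices, sums and differences are taken in the group ring $\mathbb{Z}[\mathcal{O}]$ and $1$ is its unit. The augmentation is $\varepsilon(\sum_g a_g g)=\sum_g a_g$. Modules are left modules; a homomorphism $\mathbb{Z}[\mathcal{O}]^m\to\mathbb{Z}[\mathcal{O}]^n$ is given by an $m\times n$ matrix acting on row vectors by right multiplication. *)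

(* Defs.v *)
From HB Require Import structures.
From mathcomp Require Import all_boot all_order all_algebra all_fingroup.
From mathcomp Require Import ring.
From mathcomp Require Import boolp reals.

Set Implicit Arguments.
Unset Strict Implicit.
Unset Printing Implicit Defensive.

Import Order.TTheory GRing.Theory Num.Theory.

Local Open Scope ring_scope.

Record quat (K : Type) := Quat { qre : K; qci : K; qcj : K; qck : K }.

Definition quat_tuple K (q : quat K) := (qre q, qci q, qcj q, qck q).
Definition tuple_quat K (t : K * K * K * K) : quat K :=
  let: (a, b, c, d) := t in Quat a b c d.

Lemma quat_tupleK K : cancel (@quat_tuple K) (@tuple_quat K).
Proof. by case. Qed.

HB.instance Definition _ (K : eqType) :=
  Equality.copy (quat K) (can_type (@quat_tupleK K)).
HB.instance Definition _ (K : choiceType) :=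
  Choice.copy (quat K) (can_type (@quat_tupleK K)).

Section QuatRing.
Variable K : comNzRingType.
Implicit Types p q : quat K.

Definition addq p q :=
  Quat (qre p + qre q) (qci p + qci q) (qcj p + qcj q) (qck p + qck q).
Definition oppq p := Quat (- qre p) (- qci p) (- qcj p) (- qck p).
Definition zeroq : quat K := Quat 0 0 0 0.
Definition oneq : quat K := Quat 1 0 0 0.
Definition mulq p q := Quat
  (qre p * qre q - qci p * qci q - qcj p * qcj q - qck p * qck q)
  (qre p * qci q + qci p * qre q + qcj p * qck q - qck p * qcj q)
  (qre p * qcj q - qci p * qck q + qcj p * qre q + qck p * qci q)
  (qre p * qck q + qci p * qcj q - qcj p * qci q + qck p * qre q).
Definition scaleq (a : K) q :=
  Quat (a * qre q) (a * qci q) (a * qcj q) (a * qck q).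
Definition conjq q := Quat (qre q) (- qci q) (- qcj q) (- qck q).
Definition sqnormq q := qre q ^+ 2 + qci q ^+ 2 + qcj q ^+ 2 + qck q ^+ 2.

Lemma addqA : associative addq.
Proof. by move=> [????] [????] [????]; rewrite /addq /= !addrA. Qed.
Lemma addqC : commutative addq.
Proof. by move=> [????] [????]; congr Quat; rewrite /= addrC. Qed.
Lemma add0q : left_id zeroq addq.
Proof. by move=> [????]; rewrite /addq /= !add0r. Qed.
Lemma addNq : left_inverse zeroq oppq addq.
Proof. by move=> [????]; rewrite /addq /= !addNr. Qed.

HB.instance Definition _ :=
  GRing.isZmodule.Build (quat K) addqA addqC add0q addNq.

Lemma mulqA : associative mulq.
Proof. by move=> [????] [????] [????]; congr Quat => /=; ring. Qed.
Lemma mul1q : left_id oneq mulq.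
Proof. by move=> [????]; congr Quat => /=; ring. Qed.
Lemma mulq1 : right_id oneq mulq.
Proof. by move=> [????]; congr Quat => /=; ring. Qed.
Lemma mulqDl : left_distributive mulq +%R.
Proof. by move=> [????] [????] [????]; congr Quat => /=; ring. Qed.
Lemma mulqDr : right_distributive mulq +%R.
Proof. by move=> [????] [????] [????]; congr Quat => /=; ring. Qed.
Lemma oneq_neq0 : oneq != 0.
Proof. by apply/eqP => -[/eqP]; rewrite oner_eq0. Qed.

HB.instance Definition _ := GRing.Zmodule_isNzRing.Build (quat K)
  mulqA mul1q mulq1 mulqDl mulqDr oneq_neq0.

Lemma scaleqA a b q : scaleq a (scaleq b q) = scaleq (a * b) q.
Proof. by congr Quat => /=; ring. Qed.
Lemma scale1q : left_id 1 scaleq.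
Proof. by move=> [????]; congr Quat => /=; ring. Qed.
Lemma scaleqDr : right_distributive scaleq +%R.
Proof. by move=> a [????] [????]; congr Quat => /=; ring. Qed.
Lemma scaleqDl q : {morph scaleq^~ q : a b / a + b}.
Proof. by move=> a b; congr Quat => /=; ring. Qed.

HB.instance Definition _ := GRing.Zmodule_isLmodule.Build K (quat K)
  scaleqA scale1q scaleqDr scaleqDl.

Lemma mulqE p q : p * q = mulq p q. Proof. by []. Qed.

Lemma sqnormqM p q : sqnormq (p * q) = sqnormq p * sqnormq q.
Proof. by rewrite /sqnormq /=; ring. Qed.

Lemma sqnorm_conjq q : sqnormq (conjq q) = sqnormq q.
Proof. by rewrite /sqnormq /=; ring. Qed.

Lemma conjq_mull q : sqnormq q = 1 -> conjq q * q = 1.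
Proof. by move=> q1; congr Quat => /=; [rewrite -q1 /sqnormq|..]; ring. Qed.

Lemma conjq_mulr q : sqnormq q = 1 -> q * conjq q = 1.
Proof. by move=> q1; congr Quat => /=; [rewrite -q1 /sqnormq|..]; ring. Qed.

End QuatRing.

Definition quat_i (K : comNzRingType) : quat K := Quat 0 1 0 0.
Definition quat_j (K : comNzRingType) : quat K := Quat 0 0 1 0.
Definition quat_k (K : comNzRingType) : quat K := Quat 0 0 0 1.

Record sphere3 (K : comNzRingType) :=
  Sphere3 { sphere3_val :> quat K; _ : sqnormq sphere3_val == 1 }.

HB.instance Definition _ (K : comNzRingType) := [isSub for @sphere3_val K].
HB.instance Definition _ (K : comNzRingType) := [Choice of sphere3 K by <:].

Section SphereGroup.
Variable K : comNzRingType.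
Implicit Types x y z : sphere3 K.

Fact sphere3_one_subproof : sqnormq (1 : quat K) == 1.
Proof. by apply/eqP; rewrite /sqnormq /=; ring. Qed.

Fact sphere3_mul_subproof x y : sqnormq (val x * val y) == 1.
Proof. by rewrite sqnormqM (eqP (valP x)) (eqP (valP y)) mulr1. Qed.

Fact sphere3_inv_subproof x : sqnormq (conjq (val x)) == 1.
Proof. by rewrite sqnorm_conjq (valP x). Qed.

Definition sphere3_one := Sphere3 sphere3_one_subproof.
Definition sphere3_mul x y := Sphere3 (sphere3_mul_subproof x y).
Definition sphere3_inv x := Sphere3 (sphere3_inv_subproof x).

Lemma sphere3_mulA : associative sphere3_mul.
Proof. by move=> x y z; apply: val_inj; rewrite /= mulrA. Qed.
Lemma sphere3_mul1 : left_id sphere3_one sphere3_mul.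
Proof. by move=> x; apply: val_inj; rewrite /= mul1r. Qed.
Lemma sphere3_mulr1 : right_id sphere3_one sphere3_mul.
Proof. by move=> x; apply: val_inj; rewrite /= mulr1. Qed.
Lemma sphere3_mulV : left_inverse sphere3_one sphere3_inv sphere3_mul.
Proof. by move=> x; apply: val_inj; apply/conjq_mull/eqP/(valP x). Qed.
Lemma sphere3_mulrV : right_inverse sphere3_one sphere3_inv sphere3_mul.
Proof. by move=> x; apply: val_inj; apply/conjq_mulr/eqP/(valP x). Qed.

HB.instance Definition _ := isGroup.Build (sphere3 K)
  sphere3_mulA sphere3_mul1 sphere3_mulr1 sphere3_mulV sphere3_mulrV.

End SphereGroup.

Definition generated_subgroup (G : groupType) (A : {pred G}) : pred G :=
  fun x => `[< forall H : {pred G},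
                 group_closed H -> {subset A <= H} -> x \in H >].

Lemma generated_subgroup_closed (G : groupType) (A : {pred G}) :
  group_closed (generated_subgroup A).
Proof.
split=> [|x y /asboolP xA /asboolP yA]; apply/asboolP => H clH AH.
  by case: clH.
by case: (clH) => _; apply; [apply: xA | apply: yA].
Qed.

Lemma sub_generated_subgroup (G : groupType) (A : {pred G}) :
  {subset A <= generated_subgroup A}.
Proof. by move=> x xA; apply/asboolP => H _; apply. Qed.

(* Integral codes for the 48 elements of the binary octahedral group, used only
   to prove that it is finite: [(b, q)] encodes [q / sqrt 2] if [b] holds, and
   [q / 2] otherwise. *)
Definition octa_code := (bool * quat int)%type.

Definition octa_codes : seq octa_code :=
  let r := [:: -2; -1; 0; 1; 2] : seq int in
  let s := [seq Quat t.1.1 t.1.2 t.2.1 t.2.2 |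
             t <- [seq (u, v) | u <- [seq (a, b) | a <- r, b <- r],
                                v <- [seq (a, b) | a <- r, b <- r]]] in
  [seq (false, q) | q <- s & sqnormq q == 4]
    ++ [seq (true, q) | q <- s & sqnormq q == 2].

Definition halfq (q : quat int) : quat int :=
  Quat (qre q %/ 2)%Z (qci q %/ 2)%Z (qcj q %/ 2)%Z (qck q %/ 2)%Z.

Definition code_mul (x y : octa_code) : octa_code :=
  let p := x.2 * y.2 in
  if x.1 && y.1 then (false, p) else (x.1 || y.1, halfq p).
Definition code_inv (x : octa_code) : octa_code := (x.1, conjq x.2).
Definition code_one : octa_code := (false, Quat 2 0 0 0).
Definition code_omega : octa_code := (false, Quat (-1) 1 1 1).
Definition code_tau : octa_code := (true, Quat 1 1 0 0).

Definition code_mul_ok (x y : octa_code) :=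
  (x.1 && y.1) || (let p := x.2 * y.2 in halfq p + halfq p == p).

Lemma octa_codes_mul :
  all (fun x => all (fun y =>
    code_mul_ok x y && (code_mul x y \in octa_codes)) octa_codes) octa_codes.
Proof. by vm_compute. Qed.

Lemma octa_codes_inv :
  all (fun x => code_inv x \in octa_codes) octa_codes.
Proof. by vm_compute. Qed.

Definition code_step (s : seq octa_code) : seq octa_code :=
  undup (s ++ [seq code_mul x code_omega | x <- s]
           ++ [seq code_mul x code_tau | x <- s]).

Lemma octa_codes_gen :
  all (fun x => x \in iter 12 code_step [:: code_one]) octa_codes.
Proof. by vm_compute. Qed.

Lemma octa_codes_mulV :
  all (fun x => code_mul x (code_inv x) == code_one) octa_codes.
Proof. by vm_compute. Qed.

Lemma octa_codes_sep :
  all (fun x => all (fun y => (x.1 == y.1) ||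
    ~~ [&& qre x.2 ^+ 2 == 2 * qre y.2 ^+ 2, qci x.2 ^+ 2 == 2 * qci y.2 ^+ 2,
           qcj x.2 ^+ 2 == 2 * qcj y.2 ^+ 2 & qck x.2 ^+ 2 == 2 * qck y.2 ^+ 2])
    octa_codes) octa_codes.
Proof. by vm_compute. Qed.

Lemma uniq_octa_codes : uniq octa_codes. Proof. by vm_compute. Qed.
Lemma size_octa_codes : size octa_codes = 48%N. Proof. by vm_compute. Qed.

Section Octahedral.
Variable R : realType.

Local Notation i := (quat_i R).
Local Notation j := (quat_j R).
Local Notation k := (quat_k R).
Local Notation sqrt2 := (Num.sqrt (2 : R)).

Lemma sqrt2_sqnorm (q : quat R) :
  sqnormq q = 2 -> sqnormq (sqrt2^-1 *: q) == 1.
Proof.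
move=> q2; have -> : sqnormq (sqrt2^-1 *: q) = sqrt2^-1 ^+ 2 * sqnormq q.
  by rewrite /sqnormq /=; ring.
by rewrite q2 exprVn sqr_sqrtr ?ler0n // mulVf // pnatr_eq0.
Qed.

Fact octa_gen_omega_subproof : sqnormq (2^-1 *: (- 1 + i + j + k)) == 1.
Proof. by apply/eqP; rewrite /sqnormq /=; field. Qed.
Fact omega_i_subproof : sqnormq (2^-1 *: (1 - i + j + k)) == 1.
Proof. by apply/eqP; rewrite /sqnormq /=; field. Qed.
Fact omega_j_subproof : sqnormq (2^-1 *: (1 + i - j + k)) == 1.
Proof. by apply/eqP; rewrite /sqnormq /=; field. Qed.
Fact omega_k_subproof : sqnormq (2^-1 *: (1 + i + j - k)) == 1.
Proof. by apply/eqP; rewrite /sqnormq /=; field. Qed.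
Fact tau_i_subproof : sqnormq (sqrt2^-1 *: (1 + i)) == 1.
Proof. by apply: sqrt2_sqnorm; rewrite /sqnormq /=; ring. Qed.
Fact tau_j_subproof : sqnormq (sqrt2^-1 *: (1 + j)) == 1.
Proof. by apply: sqrt2_sqnorm; rewrite /sqnormq /=; ring. Qed.
Fact tau_k_subproof : sqnormq (sqrt2^-1 *: (1 + k)) == 1.
Proof. by apply: sqrt2_sqnorm; rewrite /sqnormq /=; ring. Qed.

Definition S3_gen : sphere3 R := Sphere3 octa_gen_omega_subproof.
Definition S3_omega_i : sphere3 R := Sphere3 omega_i_subproof.
Definition S3_omega_j : sphere3 R := Sphere3 omega_j_subproof.
Definition S3_omega_k : sphere3 R := Sphere3 omega_k_subproof.
Definition S3_tau_i : sphere3 R := Sphere3 tau_i_subproof.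
Definition S3_tau_j : sphere3 R := Sphere3 tau_j_subproof.
Definition S3_tau_k : sphere3 R := Sphere3 tau_k_subproof.

Definition octa_pred : pred (sphere3 R) :=
  generated_subgroup (mem [:: S3_gen; S3_tau_i]).

Definition code_coef (b : bool) : R := if b then sqrt2^-1 else 2^-1.
Definition intq (q : quat int) : quat R :=
  Quat (qre q)%:~R (qci q)%:~R (qcj q)%:~R (qck q)%:~R.
Definition code_val (x : octa_code) : quat R := code_coef x.1 *: intq x.2.

Lemma sqrt2_neq0 : sqrt2 != 0.
Proof. by rewrite gt_eqF // sqrtr_gt0 ltr0n. Qed.

Lemma sqr_sqrt2V : sqrt2^-1 * sqrt2^-1 = 2^-1.
Proof. by rewrite -expr2 exprVn sqr_sqrtr ?ler0n. Qed.

Lemma code_val_mul_raw x y : code_val x * code_val y =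
  (code_coef x.1 * code_coef y.1) *: intq (x.2 * y.2).
Proof. by congr Quat => /=; ring. Qed.

Lemma intqD p q : intq (p + q) = intq p + intq q.
Proof. by congr Quat => /=; ring. Qed.

Lemma code_val_mul x y : x \in octa_codes -> y \in octa_codes ->
  code_val x * code_val y = code_val (code_mul x y).
Proof.
move=> xL yL; have /andP[ok _] := allP (allP octa_codes_mul x xL) y yL.
rewrite code_val_mul_raw; case: x y ok {xL yL} => [b p] [c q].
rewrite /code_mul_ok /code_mul /code_val /=.
case: ifP => [/andP[-> ->] _|bc /eqP e] /=.
  by rewrite /code_coef sqr_sqrt2V.
rewrite -{1}e intqD -mulr2n -scaler_nat scalerA; congr (_ *: _).
by case: b c bc => [] [] //= _; rewrite /code_coef; field; rewrite ?sqrt2_neq0 //.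
Qed.

Lemma code_val_inv x : code_val (code_inv x) = conjq (code_val x).
Proof. by congr Quat => /=; ring. Qed.

Lemma code_val1 : code_val code_one = 1.
Proof. by congr Quat; rewrite /= /code_coef /=; field. Qed.

Lemma code_val_inj : {in octa_codes &, injective code_val}.
Proof.
have coef0 b : code_coef b != 0.
  by case: b; rewrite /code_coef invr_eq0 ?sqrt2_neq0 ?pnatr_eq0.
move=> x y xL yL e.
have [bxy|/negPf bxy] := eqVneq x.1 y.1.
  case: x y bxy e {xL yL} => [b [????]] [c [????]] /= <- [].
  by do 4![move=> /(mulfI (coef0 b)) /intr_inj ->].
wlog xt : x y xL yL e bxy / x.1 = false.
  move=> wl; case: (boolP x.1) => [xt|/negPf]; last exact: wl.
  apply/esym/wl => //; first by rewrite eq_sym.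
  by move: bxy; rewrite xt; case: y.1.
have yt : y.1 by move: bxy; rewrite xt; case: y.1.
have sep := allP (allP octa_codes_sep x xL) y yL.
move: sep; rewrite xt yt /= => /negP[].
have aux (a b : int) :
    code_coef false * a%:~R = code_coef true * b%:~R -> a ^+ 2 == 2 * b ^+ 2.
  move=> /(congr1 (fun t => t ^+ 2)); rewrite /code_coef !exprMn [sqrt2^-1 ^+ 2]sqr_sqrt2V.
  move=> h; have {}h : (a%:~R : R) ^+ 2 = 2 * b%:~R ^+ 2.
    have -> : (a%:~R : R) ^+ 2 = 4 * (2^-1 ^+ 2 * a%:~R ^+ 2) by field.
    by rewrite h; field.
  apply/eqP/(@intr_inj R); rewrite !expr2 !intrM -expr2 h; ring.
case: x y xt yt e {xL yL bxy} => [b [????]] [c [????]] /= -> -> [] /=.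
by move=> /aux -> /aux -> /aux -> /aux ->.
Qed.

Lemma code_val_sphere c : c \in octa_codes -> sqnormq (code_val c) == 1.
Proof.
move=> cL; have -> : sqnormq (code_val c) = qre (code_val c * conjq (code_val c)).
  by rewrite /sqnormq /=; ring.
have ciL := allP octa_codes_inv c cL.
rewrite -code_val_inv code_val_mul //.
have : code_mul c (code_inv c) == code_one by exact: (allP octa_codes_mulV c cL).
by move=> /eqP ->; rewrite code_val1.
Qed.

Definition S3_codes : {pred sphere3 R} :=
  fun x => val x \in [seq code_val c | c <- octa_codes].

Lemma S3_codes_closed : group_closed S3_codes.
Proof.
split; first by apply/mapP; exists code_one; rewrite ?code_val1.
move=> x y /mapP[c cL xc] /mapP[d dL yd]; apply/mapP.
have diL := allP octa_codes_inv d dL.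
exists (code_mul c (code_inv d)).
  by have /andP[] := allP (allP octa_codes_mul c cL) _ diL.
by rewrite -code_val_mul // code_val_inv -xc -yd.
Qed.

Lemma val_S3_gen : val S3_gen = code_val code_omega.
Proof. by congr Quat; rewrite /= /code_coef; ring. Qed.
Lemma val_S3_tau_i : val S3_tau_i = code_val code_tau.
Proof. by congr Quat; rewrite /= /code_coef; ring. Qed.

Lemma octa_pred_sub x : octa_pred x -> x \in S3_codes.
Proof.
move=> /asboolP; apply; first exact: S3_codes_closed.
move=> y; rewrite !inE => /orP[] /eqP ->; apply/mapP.
  by exists code_omega; rewrite ?val_S3_gen.
by exists code_tau; rewrite ?val_S3_tau_i.
Qed.

Lemma octa_pred_sup c : c \in octa_codes ->
  exists2 x, octa_pred x & val x = code_val c.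
Proof.
have gcl := @generated_subgroup_closed _ (mem [:: S3_gen; S3_tau_i]).
have gom : S3_gen \in octa_pred.
  by apply: sub_generated_subgroup; rewrite !inE eqxx.
have gta : S3_tau_i \in octa_pred.
  by apply: sub_generated_subgroup; rewrite !inE eqxx orbT.
pose P c := c \in octa_codes /\ exists2 x, x \in octa_pred & val x = code_val c.
have Pmul c1 c2 : P c1 -> P c2 -> P (code_mul c1 c2).
  move=> [c1L [x xP xc]] [c2L [y yP yc]]; split.
    by have /andP[] := allP (allP octa_codes_mul _ c1L) _ c2L.
  exists (x * y)%g; first exact: (group_closedM gcl).
  by rewrite -code_val_mul // -xc -yc.
have Pom : P code_omega by split=> //; exists S3_gen; rewrite ?val_S3_gen.
have Pta : P code_tau by split=> //; exists S3_tau_i; rewrite ?val_S3_tau_i.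
have Pn n d : d \in iter n code_step [:: code_one] -> P d.
  elim: n d => [|n IHn] d.
    rewrite inE => /eqP ->; split=> //; exists 1%g; rewrite ?code_val1 //.
    exact: (proj1 gcl).
  rewrite iterS mem_undup !mem_cat => /orP[/IHn //|/orP[] /mapP[e /IHn eP ->]];
    exact: Pmul.
by move=> cL; have [] := Pn _ _ (allP octa_codes_gen c cL).
Qed.

Lemma octa_predE x : octa_pred x = (val x \in [seq code_val c | c <- octa_codes]).
Proof.
apply/idP/idP; first exact: octa_pred_sub.
by move=> /mapP[c /octa_pred_sup[y yP yc] xc]; rewrite (val_inj (etrans xc (esym yc))).
Qed.

Definition octa_enum : seq (sphere3 R) :=
  pmap insub [seq code_val c | c <- octa_codes].

Lemma octa_enum_uniq : uniq octa_enum.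
Proof.
apply: pmap_sub_uniq; rewrite map_inj_in_uniq ?uniq_octa_codes //.
exact: code_val_inj.
Qed.

Lemma mem_octa_enum x : (x \in octa_enum) = octa_pred x.
Proof. by rewrite mem_pmap_sub octa_predE. Qed.

Lemma size_octa_enum : size octa_enum = 48%N.
Proof.
rewrite size_pmap_sub -[RHS]size_octa_codes -(size_map code_val).
apply/eqP; rewrite -all_count; apply/allP => _ /mapP[c cL ->].
exact: code_val_sphere.
Qed.

End Octahedral.

(* The subgroup of [S^3] generated by [(-1 + i + j + k) / 2] and
   [(1 + i) / sqrt 2], as a type. *)
Record octa (R : realType) :=
  Octa { octa_val :> sphere3 R; _ : octa_pred octa_val }.

HB.instance Definition _ (R : realType) := [isSub for @octa_val R].
HB.instance Definition _ (R : realType) := [Choice of octa R by <:].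
HB.instance Definition _ (R : realType) :=
  SubChoice_isSubGroup.Build (sphere3 R) (@octa_pred R) (octa R)
    (generated_subgroup_closed _).

Section OctaFinite.
Variable R : realType.

Definition octa_seq : seq (octa R) := pmap insub (octa_enum R).

Lemma octa_seq_uniq : uniq octa_seq.
Proof. exact/pmap_sub_uniq/octa_enum_uniq. Qed.

Lemma mem_octa_seq x : x \in octa_seq.
Proof. by rewrite mem_pmap_sub mem_octa_enum (valP x). Qed.

Lemma octa_seqK : pcancel (index^~ octa_seq) (onth octa_seq).
Proof. by move=> x; rewrite onthE (nth_map x) ?index_mem ?nth_index ?mem_octa_seq. Qed.

HB.instance Definition _ := Choice_isCountable.Build (octa R) octa_seqK.
HB.instance Definition _ := isFinite.Build (octa R)
  (Finite.uniq_enumP octa_seq_uniq mem_octa_seq).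

Lemma card_octa : #|{: octa R}| = 48%N.
Proof.
have -> : #|{: octa R}| = size octa_seq.
  rewrite -(card_uniqP octa_seq_uniq).
  by apply: eq_card => x; rewrite mem_octa_seq inE.
rewrite size_pmap_sub -(size_octa_enum R).
by apply/eqP; rewrite -all_count; apply/allP => x; rewrite mem_octa_enum.
Qed.

End OctaFinite.

(* [x : group_ring gT] is the formal sum [\sum_g x g * g] with integer
   coefficients. *)
Definition group_ring (gT : finGroupType) : Type := {ffun gT -> int}.

HB.instance Definition _ (gT : finGroupType) :=
  GRing.Zmodule.copy (group_ring gT) {ffun gT -> int}.

(* [Z], on which [x] acts as multiplication by its augmentation, i.e. every
   group element acts as the identity. *)
Definition trivial_module (gT : finGroupType) : Type := int.

HB.instance Definition _ (gT : finGroupType) :=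
  GRing.Zmodule.copy (trivial_module gT) int.

Section GroupRing.
Variable gT : finGroupType.
Implicit Types x y z : group_ring gT.

Definition gr_elt (g : gT) : group_ring gT := [ffun h => (h == g)%:Z].
Definition gr_mul x y : group_ring gT :=
  [ffun g => \sum_h x h * y (h^-1 * g)%g].

Lemma gr_mulA : associative gr_mul.
Proof.
move=> x y z; apply/ffunP => g; rewrite !ffunE.
under eq_bigr => h _ do rewrite ffunE big_distrr /=.
under [RHS]eq_bigr => h _ do rewrite ffunE big_distrl /=.
rewrite [RHS]exchange_big /=; apply: eq_bigr => h _.
rewrite [RHS](reindex_inj (mulgI h)) /=; apply: eq_bigr => k _.
by rewrite mulKg invMg mulrA mulgA.
Qed.

Lemma gr_mul1 : left_id (gr_elt 1%g) gr_mul.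
Proof.
move=> x; apply/ffunP => g; rewrite ffunE (bigD1 1%g) //= ffunE eqxx mul1r.
by rewrite invg1 mul1g big1 ?addr0 // => h /negPf h1; rewrite ffunE h1 mul0r.
Qed.

Lemma gr_mulr1 : right_id (gr_elt 1%g) gr_mul.
Proof.
move=> x; apply/ffunP => g; rewrite ffunE (bigD1 g) //= ffunE mulVg eqxx mulr1.
rewrite big1 ?addr0 // => h /negPf hg; rewrite ffunE.
by rewrite -eq_mulVg1 hg mulr0.
Qed.

Lemma gr_eltM g h : gr_mul (gr_elt g) (gr_elt h) = gr_elt (g * h)%g.
Proof.
apply/ffunP => u; rewrite ffunE (bigD1 g) //= !ffunE eqxx mul1r.
rewrite big1 ?addr0 => [|v /negPf vg]; last by rewrite ffunE vg mul0r.
by congr (nat_of_bool _)%:Z; apply/eqP/eqP => [<-|->]; rewrite ?mulKg ?mulKVg.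
Qed.

Lemma gr_mulDl : left_distributive gr_mul +%R.
Proof.
move=> x y z; apply/ffunP => g; rewrite !ffunE -big_split /=.
by apply: eq_bigr => h _; rewrite ffunE mulrDl.
Qed.

Lemma gr_mulDr : right_distributive gr_mul +%R.
Proof.
move=> x y z; apply/ffunP => g; rewrite !ffunE -big_split /=.
by apply: eq_bigr => h _; rewrite ffunE mulrDr.
Qed.

Lemma gr_one_neq0 : gr_elt 1%g != 0.
Proof. by apply/eqP => /ffunP/(_ 1%g); rewrite !ffunE eqxx. Qed.

HB.instance Definition _ := GRing.Zmodule_isNzRing.Build (group_ring gT)
  gr_mulA gr_mul1 gr_mulr1 gr_mulDl gr_mulDr gr_one_neq0.

Definition augmentation x : int := \sum_g x g.

Lemma augmentationD x y :
  augmentation (x + y) = augmentation x + augmentation y.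
Proof. by rewrite -big_split; apply: eq_bigr => g _; rewrite ffunE. Qed.

Lemma augmentation1 : augmentation 1 = 1.
Proof.
rewrite /augmentation (bigD1 1%g) //= ffunE eqxx big1 ?addr0 //.
by move=> h /negPf h1; rewrite ffunE h1.
Qed.

Lemma augmentationM x y :
  augmentation (x * y) = augmentation x * augmentation y.
Proof.
rewrite /augmentation big_distrl /=.
under eq_bigr => g _ do rewrite ffunE.
rewrite exchange_big; apply: eq_bigr => h _ /=.
rewrite big_distrr /= (reindex_inj (mulgI h)) /=.
by apply: eq_bigr => k _; rewrite mulKg.
Qed.

Definition trivial_scale x (n : trivial_module gT) : trivial_module gT :=
  augmentation x * (n : int).

Lemma trivial_scaleA x y n :
  trivial_scale x (trivial_scale y n) = trivial_scale (x * y) n.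
Proof. by rewrite /trivial_scale augmentationM mulrA. Qed.
Lemma trivial_scale1 : left_id 1 trivial_scale.
Proof. by move=> n; rewrite /trivial_scale augmentation1 mul1r. Qed.
Lemma trivial_scaleDr : right_distributive trivial_scale +%R.
Proof. by move=> x m n; rewrite /trivial_scale mulrDr. Qed.
Lemma trivial_scaleDl n : {morph trivial_scale^~ n : x y / x + y}.
Proof. by move=> x y; rewrite /trivial_scale augmentationD mulrDl. Qed.

HB.instance Definition _ :=
  GRing.Zmodule_isLmodule.Build (group_ring gT) (trivial_module gT)
    trivial_scaleA trivial_scale1 trivial_scaleDr trivial_scaleDl.

Definition row_augmentation (v : 'rV[group_ring gT]_1) : trivial_module gT :=
  augmentation (v 0 0).

Lemma row_augmentation_is_linear : linear row_augmentation.
Proof.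
move=> x u v; rewrite /row_augmentation !mxE augmentationD.
by rewrite augmentationM.
Qed.

HB.instance Definition _ :=
  GRing.isLinear.Build (group_ring gT) 'rV[group_ring gT]_1
    (trivial_module gT) _ row_augmentation row_augmentation_is_linear.

End GroupRing.

Definition free_of_finite_rank (A : nzRingType) (V : lmodType A) : Prop :=
  exists n (b : 'I_n -> V),
    forall v, exists! c : 'rV[A]_n, v = \sum_(i < n) c 0 i *: b i.

(* [d m] is the differential from degree [m.+1] to degree [m]. *)
Record free_resolution (A : nzRingType) (M : lmodType A)
    (F : nat -> lmodType A) (d : forall m, {linear F m.+1 -> F m})
    (eps : {linear F 0%N -> M}) : Prop := FreeResolution {
  resolution_free : forall m, free_of_finite_rank (F m);
  resolution_surj : forall z : M, exists x, eps x = z;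
  resolution_exact0 : forall x : F 0%N, eps x = 0 <-> exists y, d 0%N y = x;
  resolution_exact : forall m (x : F m.+1),
    d m x = 0 <-> exists y, d m.+1 y = x
}.

Section OctahedralComplex.
Variable R : realType.

Local Notation ZO := (group_ring (octa R)).

Fact octa_omega_i_subproof : octa_pred (S3_omega_i R).
Proof.
rewrite octa_predE; apply/mapP; exists (false, Quat 1 (-1) 1 1) => //.
by congr Quat; rewrite /= /code_coef; ring.
Qed.
Fact octa_omega_j_subproof : octa_pred (S3_omega_j R).
Proof.
rewrite octa_predE; apply/mapP; exists (false, Quat 1 1 (-1) 1) => //.
by congr Quat; rewrite /= /code_coef; ring.
Qed.
Fact octa_omega_k_subproof : octa_pred (S3_omega_k R).
Proof.
rewrite octa_predE; apply/mapP; exists (false, Quat 1 1 1 (-1)) => //.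
by congr Quat; rewrite /= /code_coef; ring.
Qed.
Fact octa_tau_i_subproof : octa_pred (S3_tau_i R).
Proof.
rewrite octa_predE; apply/mapP; exists (true, Quat 1 1 0 0) => //.
by congr Quat; rewrite /= /code_coef; ring.
Qed.
Fact octa_tau_j_subproof : octa_pred (S3_tau_j R).
Proof.
rewrite octa_predE; apply/mapP; exists (true, Quat 1 0 1 0) => //.
by congr Quat; rewrite /= /code_coef; ring.
Qed.
Fact octa_tau_k_subproof : octa_pred (S3_tau_k R).
Proof.
rewrite octa_predE; apply/mapP; exists (true, Quat 1 0 0 1) => //.
by congr Quat; rewrite /= /code_coef; ring.
Qed.

Definition omega_i : octa R := Octa octa_omega_i_subproof.
Definition omega_j : octa R := Octa octa_omega_j_subproof.
Definition omega_k : octa R := Octa octa_omega_k_subproof.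
Definition tau_i : octa R := Octa octa_tau_i_subproof.
Definition tau_j : octa R := Octa octa_tau_j_subproof.
Definition tau_k : octa R := Octa octa_tau_k_subproof.

Local Notation "[ g ]" := (gr_elt g) (at level 0, g at level 99).

Definition octa_bd1 : 'M[ZO]_(3, 1) :=
  \col_(r < 3) [:: [tau_i] - 1; [tau_j] - 1; [tau_k] - 1]`_r.

Definition octa_bd2 : 'M[ZO]_(3, 3) :=
  \matrix_(r < 3, c < 3) (nth [::]
    [:: [:: [omega_i];   [tau_k] - 1; 1          ];
        [:: 1;           [omega_j];   [tau_i] - 1];
        [:: [tau_j] - 1; 1;           [omega_k]  ]] r)`_c.

Definition octa_bd3 : 'M[ZO]_(1, 3) :=
  \row_(c < 3) [:: 1 - [tau_i]; 1 - [tau_j]; 1 - [tau_k]]`_c.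

Definition octa_bd4 : 'M[ZO]_(1, 1) := (\sum_(g : octa R) [g])%:M.

End OctahedralComplex.

Fixpoint octa_rank (m : nat) : nat :=
  match m with
  | 0 => 1 | 1 => 3 | 2 => 3 | 3 => 1
  | m'.+4 => octa_rank m'
  end%N.

Lemma octa_rankE m :
  octa_rank m = if (m %% 4 == 0)%N || (m %% 4 == 3)%N then 1%N else 3%N.
Proof.
have [n] := ubnP m; elim: n m => // n IHn [|[|[|[|m]]]] //= mn.
have -> : (m.+4 %% 4 = m %% 4)%N by rewrite -addn4 modnDr.
apply: IHn; move: mn; rewrite ltnS; apply: leq_trans.
by rewrite ltnS -addn3 leq_addr.
Qed.

(* [octa_bd R m] is the matrix of the boundary map from degree [m.+1] to degree
   [m], usually written with the index [m.+1]; row vectors are multiplied by it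
   on the right, so its rows are indexed by the basis of the source. *)
Fixpoint octa_bd (R : realType) (m : nat) :
    'M[group_ring (octa R)]_(octa_rank m.+1, octa_rank m) :=
  match m with
  | 0 => octa_bd1 R | 1 => octa_bd2 R | 2 => octa_bd3 R | 3 => octa_bd4 R
  | m'.+4 => octa_bd R m'
  end%N.

Definition octa_term (R : realType) (m : nat) : lmodType (group_ring (octa R)) :=
  'rV[group_ring (octa R)]_(octa_rank m).

Definition octa_diff (R : realType) (m : nat) :
    {linear octa_term R m.+1 -> octa_term R m} :=
  mulmxr (octa_bd R m).

Definition octa_augmentation (R : realType) :
    {linear octa_term R 0%N -> trivial_module (octa R)} :=
  @row_augmentation (octa R).

(* Main.v *)
Require Import Defs.
From HB Require Import structures.
From mathcomp Require Import all_boot all_algebra all_fingroup reals boolp.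
From mathcomp Require Import ring.

(** Write [a, b, c] for [tau_i, tau_j, tau_k] and [O] for the group. They
generate [O], and satisfy [c b a = b], [a c b = c], [b a c = a]; moreover
[omega_i = c b], [omega_j = a c], [omega_k = b a]. Hence the rows of the second
boundary matrix are the Fox derivatives of these three relators, and the
complex begins as the one attached to a presentation of [O].

Degree 0: the differences [g - 1] span the augmentation ideal, and
[g h - 1 = g (h - 1) + (g - 1)] reduces them to the generators.

Degree 1: exactness says that the three relators present [O]. In any group,
elements satisfying them also satisfy [a b = b c = c a], [a b^2 a = b^2],
[a^4 = b^4] and [a^8 = 1], and the 48 products [a^n w] with [w] among
[1, b, b^2, b^-1, c, c^-1] are stable under multiplication
([octa_forms_mul]). As [O] has order 48, every extension of [O] in which
[a, b, c] lift to elements satisfying the relators splits compatibly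
([split_extension]). Let [M] be the cokernel of the second boundary map, and
[M ><| O] the semidirect product; the pairs (class of basis vector, generator)
satisfy the relators because the rows of the matrix vanish in [M]. The splitting
is a crossed homomorphism [D : O -> M], whose additive extension to the group
ring recovers the class of [v] from the boundary of [v] ([fox_retraction]). So
[v] is a boundary as soon as its own boundary is zero.

Degree 2: the complex is self-dual. The additive extension of [D] provides an
additive homotopy, which the pairing [(x, u) |-> coefficient of 1 in x u] turns
into exactness of the complex of columns ([dual_exact]). Conjugation by
[r = a b a c^2] composed with inversion is an anti-automorphism that exchanges
[a] and [b] and fixes [c]; it maps the second matrix to its transpose with
indices 0 and 1 exchanged, and the column of the first boundary to the row of
the third ([bd2_anti], [bd1_anti]). This carries exactness for columns back to
rows.

Degrees 3 and 4: [x (1 - a) = x (1 - b) = x (1 - c) = 0] makes the coefficients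
of [x] constant, so [x] is an integer multiple of the norm [\sum_g g]; and
[x] times the norm is the augmentation of [x] times the norm, so the kernel of
the fourth boundary is again the augmentation ideal. From there on the complex
repeats itself. *)

Set Implicit Arguments.
Unset Strict Implicit.
Unset Printing Implicit Defensive.

Import GRing.Theory.

(** * Groups generated by an octahedral triple *)

Section OctahedralTriples.
Local Open Scope group_scope.

(** The relators are permuted cyclically by [a -> c -> b -> a], so what is derived
for [(a, b, c)] also holds for [(c, a, b)] and [(b, c, a)]. *)
Definition octahedral_triple (E : groupType) (a b c : E) :=
  [/\ c * b * a = b, a * c * b = c & b * a * c = a].

Lemma octahedral_triple_rot (E : groupType) (a b c : E) :
  octahedral_triple a b c -> octahedral_triple c a b.
Proof. by case. Qed.

(** Both sides equal [b a c b]. With the rotated triples this gives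
[a b = b c = c a], the relations of the braid group on three strands. *)
Lemma octa_braid (E : groupType) (a b c : E) :
  octahedral_triple a b c -> a * b = b * c.
Proof.
by move=> [_ acb bac]; rewrite -{1}bac -!mulgA [a * _]mulgA acb.
Qed.

(** Conjugation by [b ^+ 2] inverts [a]: [a b b a = b (c b a)]. *)
Lemma octa_invert (E : groupType) (a b c : E) :
  octahedral_triple a b c -> a * b ^+ 2 * a = b ^+ 2.
Proof.
move=> abc; have [cba _ _] := abc.
by rewrite !expg2 !mulgA (octa_braid abc) -!mulgA [c * _]mulgA cba.
Qed.

(** By [a b = c a], the word [b a a b] is [(b a c) a]. *)
Lemma octa_invert' (E : groupType) (a b c : E) :
  octahedral_triple a b c -> b * a ^+ 2 * b = a ^+ 2.
Proof.
move=> abc; have [_ _ bac] := abc.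
have ca := octa_braid (octahedral_triple_rot abc).
by rewrite !expg2 -!mulgA -ca !mulgA bac.
Qed.

Lemma mulg_exp_fix (E : groupType) (x y : E) n :
  x * y * x = y -> x ^+ n * y * x ^+ n = y.
Proof.
move=> xyx; elim: n => [|n IHn]; first by rewrite mul1g mulg1.
by rewrite {1}expgSr expgS !mulgA -2!(mulgA (x ^+ n)) xyx.
Qed.

(** Squares invert each other: both fourth powers equal [(a^2 b^2)^2]. *)
Lemma octa_expg4 (E : groupType) (a b c : E) :
  octahedral_triple a b c -> a ^+ 4 = b ^+ 4.
Proof.
move=> abc; have ia := mulg_exp_fix 2 (octa_invert abc).
have ib := mulg_exp_fix 2 (octa_invert' abc).
by rewrite (expgnDr a 2 2) -{2}ib (mulgA _ (_ * _)) (mulgA _ (b ^+ 2)) ia -expgnDr.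
Qed.

(** [a ^+ 4 = b ^+ 4] commutes with [b ^+ 2] and is also inverted by it. *)
Lemma octa_expg8 (E : groupType) (a b c : E) :
  octahedral_triple a b c -> a ^+ 8 = 1.
Proof.
move=> abc; have a4b4 := octa_expg4 abc.
move: (mulg_exp_fix 4 (octa_invert abc)); rewrite {1}a4b4 -expgnDr.
rewrite (expgnDr b 2 4) -[RHS]mulg1 -mulgA => /mulgI.
by rewrite -a4b4 -expgnDr.
Qed.

(** Representatives of the right cosets of the cyclic group of [a]: acting on
the octahedron, this subgroup is the stabilizer of the vertex [i], so its cosets
correspond to the six vertices [+-i, +-j, +-k]. *)
Definition octa_reps (E : groupType) (b c : E) :=
  [:: 1; b; b ^+ 2; b^-1; c; c^-1].

Definition octa_forms (E : groupType) (a b c : E) : seq E :=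
  [seq a ^+ n * w | n <- iota 0 8, w <- octa_reps b c].

Lemma octa_formsP (E : groupType) (a b c : E) n w :
  octahedral_triple a b c -> w \in octa_reps b c ->
  a ^+ n * w \in octa_forms a b c.
Proof.
move=> abc wW; rewrite (divn_eq n 8) expgnDr mulnC expgnA (octa_expg8 abc).
rewrite expg1n mul1g; apply/allpairsP; exists (n %% 8, w); split=> //.
by rewrite mem_iota /= ltn_mod.
Qed.

(** The coset enumeration: multiplying each of the six representatives by each of
[a, b, c] on the right gives a power of [a] times a representative. *)
Lemma octa_forms_mulr (E : groupType) (a b c x : E) u :
  octahedral_triple a b c -> x \in [:: a; b; c] ->
  u \in octa_forms a b c -> u * x \in octa_forms a b c.
Proof.
move=> abc xX /allpairsP[[n w] /= [_ wW ->]].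
suff [m [v [vW wx]]] : exists m v, v \in octa_reps b c /\ w * x = a ^+ m * v.
  by rewrite -mulgA wx mulgA -expgnDr octa_formsP.
have [cba acb bac] := abc.
have ab := octa_braid abc; have ca := octa_braid (octahedral_triple_rot abc).
have aV : a ^+ 7 = a^-1.
  by apply: (mulIg a); rewrite -expgSr (octa_expg8 abc) mulVg.
(* the remaining facts rewrite each product into the form [a ^+ m * v] *)
have cVa : c^-1 * a = a * b^-1 by apply: (mulgI c); rewrite mulVKg mulgA ca mulgK.
have cVb : c^-1 * b = a * c^-1 by apply: (mulgI c); rewrite mulVKg mulgA ca ab mulgK.
have ba : b * a = a * c^-1 by apply: (mulIg c); rewrite bac mulgVK.
have cb : c * b = a^-1 * c by apply: (mulgI a); rewrite mulVKg mulgA acb.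
have bVa : b^-1 * a = a * c by apply: (mulgI b); rewrite mulVKg mulgA bac.
have bVc : b^-1 * c = a^-1 * b^-1 by rewrite -invMg ba -cVb invMg invgK.
have c2 : c * c = a ^+ 2 * b ^+ 2.
  by rewrite !expg2 -mulgA (mulgA a b) ab !mulgA -ca -!mulgA (mulgA a c) acb.
move: xX wW; rewrite !inE => /or3P[] /eqP-> /or4P[|||/or3P[]] /eqP->.
(* the six representatives times [a], then times [b], then times [c] *)
1: exists 1%N, 1; rewrite mulg1 mul1g.
2: exists 1%N, c^-1; rewrite ba.
3: exists 7%N, (b ^+ 2); rewrite aV -[in RHS](octa_invert abc) -(mulgA a) mulKg.
4: exists 1%N, c; rewrite bVa.
5: exists 1%N, b; rewrite ca.
6: exists 1%N, b^-1; rewrite cVa.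
7: exists 0%N, b; rewrite !mul1g.
8: exists 0%N, (b ^+ 2); rewrite mul1g.
9: exists 4%N, b^-1; rewrite (octa_expg4 abc) -expgSr (expgSr b 3) mulgK.
10: exists 0%N, 1; rewrite mulVg mulg1.
11: exists 7%N, c; rewrite aV cb.
12: exists 1%N, c^-1; rewrite cVb.
13: exists 0%N, c; rewrite !mul1g.
14: exists 1%N, b; rewrite ab.
15: exists 2%N, c^-1; rewrite expg2 -mulgA -ab mulgA ba -mulgA cVb mulgA.
16: exists 7%N, b^-1; rewrite aV bVc.
17: exists 2%N, (b ^+ 2); rewrite c2.
18: exists 0%N, 1; rewrite mulVg mulg1.
all: by split=> //; rewrite !inE eqxx ?orbT.
Qed.

Lemma octa_forms1 (E : groupType) (a b c : E) :
  octahedral_triple a b c -> 1 \in octa_forms a b c.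
Proof.
by move=> abc; rewrite -[1]mulg1 -[X in X * 1](expg0 a) octa_formsP ?inE ?eqxx.
Qed.

(** Each [a ^+ n * w] is a product of copies of [a, b, c], since these have order
dividing 8, so stability under the generators suffices. *)
Lemma octa_forms_mul (E : groupType) (a b c : E) u v :
    octahedral_triple a b c ->
  u \in octa_forms a b c -> v \in octa_forms a b c -> u * v \in octa_forms a b c.
Proof.
move=> abc; pose stab x := forall u, u \in octa_forms a b c -> u * x \in octa_forms a b c.
suff: v \in octa_forms a b c -> stab v by move=> st uN /st; exact.
have gen x : x \in [:: a; b; c] -> stab x by move=> xX w; apply: octa_forms_mulr.
have [sa sb sc] : [/\ stab a, stab b & stab c].
  by split; apply: gen; rewrite !inE eqxx ?orbT.
have s1 : stab 1 by move=> w; rewrite mulg1.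
have sM x y : stab x -> stab y -> stab (x * y).
  by move=> sx sy w wN; rewrite mulgA; apply/sy/sx.
have sX x n : stab x -> stab (x ^+ n).
  by move=> sx; elim: n => // n IHn; rewrite expgS; apply: sM.
have sV x : x ^+ 8 = 1 -> stab x -> stab x^-1.
  move=> x8 /(sX _ 7); suff -> : x^-1 = x ^+ 7 by [].
  by apply: (mulIg x); rewrite mulVg -expgSr x8.
have c8 := octa_expg8 (octahedral_triple_rot abc).
have b8 := octa_expg8 (octahedral_triple_rot (octahedral_triple_rot abc)).
move=> /allpairsP[[n w] /= [_ wW ->]]; apply: (sM _ _ (sX _ n sa)).
move: wW; rewrite !inE => /or4P[|||/or3P[]] /eqP-> //.
- exact: sX.
- exact: sV.
- exact: sV.
Qed.

End OctahedralTriples.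

(** * Splitting extensions of groups of order 48 *)

(** In a finite group, inverses need no separate case. *)
Lemma generated_ind (G : finGroupType) (A : {set G}) (P : G -> Prop) :
    <<A>>%g = [set: G] -> P 1%g ->
    (forall x, x \in A -> P x) -> (forall x y, P x -> P y -> P (x * y)%g) ->
  forall x, P x.
Proof.
move=> genA P1 PA PM x; pose S := [set y | `[< P y >]].
have S_group : group_set S.
  apply/group_setP; split=> [|y z]; first by rewrite inE; apply/asboolP.
  by rewrite !inE => /asboolP Py /asboolP Pz; apply/asboolP/PM.
have /subsetP/(_ x (in_setT x)) : [set: G] \subset Group S_group.
  by rewrite -genA gen_subG; apply/subsetP => y yA; rewrite inE; apply/asboolP/PA.
by rewrite inE => /asboolP.
Qed.

(** A multiplicatively closed set of as many elements as [G] that covers [G] is a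
complement of the kernel. *)
Lemma bijective_section (G : finGroupType) (E : groupType) (p : E -> G) (N : seq E) :
    {morph p : x y / (x * y)%g} -> {in N &, forall u v, (u * v)%g \in N} ->
    size N = #|{: G}| -> (forall g, g \in [seq p u | u <- N]) ->
  exists f : G -> E,
    [/\ {morph f : g h / (g * h)%g}, cancel f p & {in N, cancel p f}].
Proof.
move=> pM NM N_size pN.
have pN_uniq : uniq [seq p u | u <- N].
  apply: (leq_size_uniq (enum_uniq {: G})) => [g _|]; first exact: pN.
  by rewrite -cardE size_map N_size.
have p_inj : {in N &, injective p}.
  move=> u v uN vN puv; have lt x : x \in N -> (index x N < size N)%N.
    by rewrite index_mem.
  suff e : index u N = index v N by rewrite -(nth_index u uN) e nth_index.
  apply/eqP; rewrite -(nth_uniq (p u) _ _ pN_uniq) ?size_map ?lt //.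
  by rewrite !(nth_map u) ?lt // !nth_index // puv.
have [f fP] : exists f : G -> E, forall g, f g \in N /\ p (f g) = g.
  have /boolp.choice[f fP] : forall g, exists u, u \in N /\ p u = g.
    by move=> g; have /mapP[u uN ->] := pN g; exists u.
  by exists f.
have fN g : f g \in N by case: (fP g).
have pf : cancel f p by move=> g; case: (fP g).
exists f; split=> // [g h|u uN]; last by apply: p_inj; rewrite // pf.
by apply: p_inj; rewrite ?NM // pM !pf.
Qed.

Section SplitExtension.
Local Open Scope group_scope.
Variables (G : finGroupType) (t1 t2 t3 : G).
Hypothesis gen : <<[set t1; t2; t3]>> = [set: G].
Hypothesis card_G : #|{: G}| = 48.

(** The normal forms of the lifted triple cover [G] and number 48, which is the
order of [G]; they are therefore a copy of [G] in the extension [E]. *)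
Lemma split_extension (E : groupType) (p : E -> G) (a b c : E) :
    {morph p : x y / x * y} -> octahedral_triple a b c ->
    p a = t1 -> p b = t2 -> p c = t3 ->
  exists f : G -> E,
    [/\ {morph f : g h / g * h}, cancel f p & [/\ f t1 = a, f t2 = b & f t3 = c]].
Proof.
move=> pM abc pa pb pc; set N := octa_forms a b c.
have p1 : p 1 = 1 by apply: (mulIg (p 1)); rewrite -pM !mul1g.
have NX x : x \in [:: a; b; c] -> x \in N.
  by move=> xX; rewrite -[x]mul1g; apply: octa_forms_mulr (octa_forms1 abc).
pose pN := [seq p v | v <- N].
have pN_all g : g \in pN.
  pose stab h := forall y, y \in pN -> y * h \in pN.
  have stab_p x : x \in [:: a; b; c] -> stab (p x).
    by move=> xX _ /mapP[u uN ->]; rewrite -pM map_f // octa_forms_mulr.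
  have pN1 : 1 \in pN by rewrite -p1 map_f // octa_forms1.
  (* stability under right translation passes to products *)
  rewrite -[g]mul1g; move: g 1 pN1; apply: (generated_ind gen).
  - by move=> y; rewrite mulg1.
  - move=> x; rewrite !inE -orbA -pa -pb -pc => /or3P[] /eqP->; apply: stab_p;
      by rewrite !inE eqxx ?orbT.
  - by move=> x y sx sy z /sx /sy; rewrite mulgA.
have N_size : size N = #|{: G}| by rewrite card_G size_allpairs.
have NN : {in N &, forall u v, u * v \in N} by move=> u v; apply: octa_forms_mul.
have [f [fM pf fp]] := bijective_section pM NN N_size pN_all.
by exists f; split=> //; rewrite -pa -pb -pc; split; apply: fp; apply: NX;
  rewrite !inE eqxx ?orbT.
Qed.

End SplitExtension.

(** * The binary octahedral group *)

Section OctahedralGroup.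
Variable R : realType.
Local Open Scope group_scope.

Local Notation τi := (tau_i R).
Local Notation τj := (tau_j R).
Local Notation τk := (tau_k R).

(** Products in the group are evaluated on integral codes, where equality is
decided by computation. *)
Definition code_of (g : octa R) (x : octa_code) :=
  (x \in octa_codes) && (val (val g) == code_val R x).

Lemma code_ofM g h x y :
  code_of g x -> code_of h y -> code_of (g * h) (code_mul x y).
Proof.
move=> /andP[xL /eqP gx] /andP[yL /eqP hy]; apply/andP; split.
  by have /andP[] := allP (allP octa_codes_mul x xL) y yL.
by rewrite -code_val_mul // -gx -hy.
Qed.

Lemma code_of_inj g h x : code_of g x -> code_of h x -> g = h.
Proof.
by move=> /andP[_ /eqP gx] /andP[_ /eqP hx]; do 2 apply: val_inj; rewrite gx hx.
Qed.

Lemma code_of_tau :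
  [/\ code_of τi (true, Quat 1 1 0 0)%R, code_of τj (true, Quat 1 0 1 0)%R
    & code_of τk (true, Quat 1 0 0 1)%R].
Proof. by split; apply/andP; split=> //; apply/eqP; congr Quat; rewrite /= /code_coef; ring. Qed.

Lemma code_of_omega :
  [/\ code_of (omega_i R) (false, Quat 1 (-1) 1 1)%R,
      code_of (omega_j R) (false, Quat 1 1 (-1) 1)%R
    & code_of (omega_k R) (false, Quat 1 1 1 (-1))%R].
Proof. by split; apply/andP; split=> //; apply/eqP; congr Quat; rewrite /= /code_coef; ring. Qed.

Lemma omegaE : [/\ omega_i R = τk * τj, omega_j R = τi * τk & omega_k R = τj * τi].
Proof.
have [ci cj ck] := code_of_tau; have [oi oj ok] := code_of_omega.
split; [apply: code_of_inj oi _ | apply: code_of_inj oj _ | apply: code_of_inj ok _].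
- exact: (code_ofM ck cj).
- exact: (code_ofM ci ck).
- exact: (code_ofM cj ci).
Qed.

Lemma tau_triple : octahedral_triple τi τj τk.
Proof.
have [ci cj ck] := code_of_tau.
split.
- exact: code_of_inj (code_ofM (code_ofM ck cj) ci) cj.
- exact: code_of_inj (code_ofM (code_ofM ci ck) cj) ck.
- exact: code_of_inj (code_ofM (code_ofM cj ci) ck) ci.
Qed.

(** The other generator of the group is [(tau_i tau_j)^2]. *)
Lemma tau_generate : <<[set τi; τj; τk]>> = [set: octa R].
Proof.
apply/eqP; rewrite eqEsubset subsetT; apply/subsetP => g _.
have [ci cj ck] := code_of_tau.
pose H : {pred sphere3 R} := fun y => `[< exists2 x, x \in <<[set τi; τj; τk]>> & y = val x >].
have memH x y : x \in <<[set τi; τj; τk]>> -> y = val x -> y \in H.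
  by move=> xG yx; apply/asboolP; exists x.
suff /asboolP[x xG /val_inj ->] : val g \in H by [].
have τG : {subset [:: τi; τj] <= <<[set τi; τj; τk]>>}.
  by move=> x; rewrite !inE => xS; apply/mem_gen; rewrite !inE xS.
have /asboolP := valP g; apply=> [|y].
  split=> [|x y]; first by apply: (memH 1); rewrite ?gmulf1.
  move=> /asboolP[u uG ->] /asboolP[v vG ->].
  apply: (memH (u * v^-1)); last by rewrite gmulfF.
  by apply: groupM uG _; rewrite groupV.
rewrite !inE => /orP[] /eqP->; last first.
  by apply: (memH τi) (erefl _); apply: τG; rewrite !inE eqxx.
apply: (memH (τi * τj * (τi * τj))).
  by apply: groupM; apply: groupM; apply: τG; rewrite !inE eqxx ?orbT.
apply: val_inj; have /andP[_ /eqP->] := code_ofM (code_ofM ci cj) (code_ofM ci cj).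
exact: val_S3_gen.
Qed.

End OctahedralGroup.

Local Open Scope ring_scope.

(** * Group rings *)

Section GroupRingTheory.
Variable gT : finGroupType.
Local Notation A := (group_ring gT).
Implicit Types (x y z : A) (g h : gT).

(** The coefficients as additive functions, so that sums and integer multiples
can be evaluated with the theory of such functions. *)
Definition gr_coef g x : int := x g.

Fact gr_coef_is_zmod_morphism g : zmod_morphism (gr_coef g).
Proof. by move=> x y; rewrite /gr_coef !ffunE. Qed.

HB.instance Definition _ g :=
  GRing.isZmodMorphism.Build A int (gr_coef g) (gr_coef_is_zmod_morphism g).

Fact augmentation_is_zmod_morphism : zmod_morphism (@augmentation gT).
Proof.
move=> x y; apply: (addIr (augmentation y)).
by rewrite -augmentationD !subrK.
Qed.

HB.instance Definition _ :=
  GRing.isZmodMorphism.Build A int (@augmentation gT) augmentation_is_zmod_morphism.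

Lemma gr_coef_elt g h : gr_coef h (gr_elt g) = (h == g)%:Z.
Proof. exact: ffunE. Qed.

Lemma gr_eltMr g h : gr_elt g * gr_elt h = gr_elt (g * h)%g.
Proof. exact: gr_eltM. Qed.

Lemma gr_coef_inj x y : (forall g, gr_coef g x = gr_coef g y) -> x = y.
Proof. by move=> xy; apply/ffunP. Qed.

Lemma gr_sumE x : x = \sum_g gr_elt g *~ gr_coef g x.
Proof.
apply: gr_coef_inj => h; rewrite raddf_sum (bigD1 h) //= big1 ?addr0.
  by rewrite raddfMz /= gr_coef_elt eqxx intz.
by move=> g /negPf gh; rewrite raddfMz /= gr_coef_elt eq_sym gh mul0rz.
Qed.

(** The group elements generate the group ring as an abelian group, so additive
identities need only be checked on them. *)
Lemma gr_ind (P : A -> Prop) :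
    (forall g, P (gr_elt g)) -> (forall x y, P x -> P y -> P (x - y)) ->
  forall x, P x.
Proof.
move=> Pg PB; have P0 : P 0 by rewrite -(subrr (gr_elt 1%g)); apply: PB.
have PN x : P x -> P (- x) by rewrite -sub0r; apply: PB.
have PD x y : P x -> P y -> P (x + y).
  by move=> Px Py; rewrite -[y]opprK; apply/PB/PN.
move=> x; rewrite (gr_sumE x); elim/big_ind: _ => // g _.
have PM n : P (gr_elt g *+ n).
  by elim: n => // n IHn; rewrite mulrSr; apply: PD.
by case: (gr_coef g x) => n; [|apply: PN]; apply: PM.
Qed.

Lemma augmentation_elt g : augmentation (gr_elt g) = 1.
Proof.
rewrite /augmentation (bigD1 g) //= ffunE eqxx big1 ?addr0 // => h /negPf hg.
by rewrite ffunE hg.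
Qed.

Lemma gr_coef1M g x : gr_coef 1%g (gr_elt g^-1%g * x) = gr_coef g x.
Proof.
rewrite [LHS]ffunE (bigD1 g^-1%g) //= ffunE eqxx mul1r invgK mulg1 big1 ?addr0 //.
by move=> h /negPf hg; rewrite ffunE hg mul0r.
Qed.

Section Lift.
Variables (V : zmodType) (D : gT -> V).

Definition gr_lift x : V := \sum_g D g *~ gr_coef g x.

Fact gr_lift_is_zmod_morphism : zmod_morphism gr_lift.
Proof.
move=> x y; rewrite /gr_lift -sumrB; apply: eq_bigr => g _.
by rewrite raddfB /= mulrzBr.
Qed.

HB.instance Definition _ :=
  GRing.isZmodMorphism.Build A V gr_lift gr_lift_is_zmod_morphism.

Lemma gr_lift_elt g : gr_lift (gr_elt g) = D g.
Proof.
rewrite /gr_lift (bigD1 g) //= gr_coef_elt eqxx big1 ?addr0 // => h /negPf hg.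
by rewrite gr_coef_elt hg.
Qed.

Lemma gr_lift_comp (W : zmodType) (f : {additive V -> W}) x :
  f (gr_lift x) = \sum_g f (D g) *~ gr_coef g x.
Proof. by rewrite raddf_sum; apply: eq_bigr => g _; rewrite raddfMz. Qed.
End Lift.

(** The additive extension of a crossed homomorphism is a Fox derivative. *)
Lemma fox_product (M : lmodType A) (D : gT -> M) :
    (forall g h, D (g * h)%g = D g + gr_elt g *: D h) ->
  forall x y, gr_lift D (x * y) = x *: gr_lift D y + gr_lift D x *~ augmentation y.
Proof.
move=> Dcross x y.
elim/gr_ind: x => [g|x1 x2 IH1 IH2]; last first.
  by rewrite mulrBl raddfB /= IH1 IH2 scalerBl raddfB /= mulrzBl opprD addrACA.
elim/gr_ind: y => [h|y1 y2 IH1 IH2]; last first.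
  by rewrite mulrBr !raddfB /= IH1 IH2 opprD addrACA.
by rewrite gr_eltMr !gr_lift_elt augmentation_elt Dcross addrC.
Qed.

(** The group ring is its own dual through [(y, w) |-> coefficient of 1 in y w]. *)
Lemma functional_coef (psi : {additive A -> int}) :
  exists w, forall y, psi y = gr_coef 1%g (y * w).
Proof.
exists (\sum_h gr_elt h^-1%g *~ psi (gr_elt h)) => y.
elim/gr_ind: y => [g|y1 y2 IH1 IH2]; last first.
  by rewrite mulrBl !raddfB /= IH1 IH2.
rewrite mulr_sumr raddf_sum (bigD1 g) //= big1 => [|h /negPf hg].
  by rewrite mulrzAr raddfMz /= gr_eltMr mulgV gr_coef_elt eqxx addr0 intz.
rewrite mulrzAr raddfMz /= gr_eltMr gr_coef_elt eq_sym -eq_mulgV1 eq_sym hg.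
by rewrite mul0rz.
Qed.

Lemma gr_coef1_inj x : (forall y, gr_coef 1%g (y * x) = 0) -> x = 0.
Proof. by move=> x0; apply: gr_coef_inj => g; rewrite -gr_coef1M x0 raddf0. Qed.

(** The anti-involution that inverts group elements; it exchanges left and right
modules. *)
Definition gr_star x : A := gr_lift (fun g => gr_elt g^-1%g) x.

HB.instance Definition _ := GRing.Additive.copy gr_star (gr_lift _).

Lemma gr_star_elt g : gr_star (gr_elt g) = gr_elt g^-1%g.
Proof. exact: gr_lift_elt. Qed.

Lemma gr_starM x y : gr_star (x * y) = gr_star y * gr_star x.
Proof.
elim/gr_ind: x => [g|x1 x2 IH1 IH2]; last first.
  by rewrite mulrBl !raddfB /= IH1 IH2 mulrBr.
elim/gr_ind: y => [h|y1 y2 IH1 IH2]; last first.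
  by rewrite mulrBr !raddfB /= IH1 IH2 mulrBl.
by rewrite gr_eltMr !gr_star_elt gr_eltMr invMg.
Qed.

Lemma gr_starK : involutive gr_star.
Proof.
move=> x; elim/gr_ind: x => [g|x1 x2 IH1 IH2]; last by rewrite !raddfB /= IH1 IH2.
by rewrite !gr_star_elt invgK.
Qed.

End GroupRingTheory.

(** * Cokernels and semidirect products *)

Section Cokernel.
Variables (A : nzRingType) (U V : lmodType A) (f : {linear U -> V}).

Definition im_pred : {pred V} := fun v => `[< exists u, f u = v >].

Fact im_pred_zmod_closed : zmod_closed im_pred.
Proof.
split=> [|_ _ /asboolP[u <-] /asboolP[v <-]]; apply/asboolP.
  by exists 0; rewrite raddf0.
by exists (u - v); rewrite raddfB.
Qed.

HB.instance Definition _ := GRing.isZmodClosed.Build V im_pred im_pred_zmod_closed.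

Definition coker : Type := Quotient.quot im_pred.

HB.instance Definition _ := GRing.Zmodule.copy coker (Quotient.quot im_pred).

Definition coker_pi (v : V) : coker := \pi_(Quotient.quot im_pred)%qT v.

Fact coker_pi_is_zmod_morphism : zmod_morphism coker_pi.
Proof. exact: (raddfB (\pi_(Quotient.quot im_pred))%qT). Qed.

HB.instance Definition _ :=
  GRing.isZmodMorphism.Build V coker coker_pi coker_pi_is_zmod_morphism.

(** A choice of representatives; it need not be additive. *)
Definition coker_repr (q : coker) : V := generic_quotient.repr (q : Quotient.quot im_pred).

Lemma coker_reprK : cancel coker_repr coker_pi.
Proof. exact: generic_quotient.reprK. Qed.

Lemma coker_pi_eq0 v : coker_pi v = 0 <-> exists u, f u = v.
Proof.
have e : (v \in im_pred) = (coker_pi v == 0).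
  by rewrite -{1}[v]subr0 (Quotient.idealrBE im_pred) -[X in _ == X]/(coker_pi 0) raddf0.
by split=> [/eqP|fv]; [rewrite -e => /asboolP | apply/eqP; rewrite -e; apply/asboolP].
Qed.

Definition coker_scale a q := coker_pi (a *: coker_repr q).

Lemma coker_scale_pi a v : coker_scale a (coker_pi v) = coker_pi (a *: v).
Proof.
apply/eqP; rewrite -subr_eq0 -raddfB -scalerBr; apply/eqP/coker_pi_eq0.
have [|u fu] := (coker_pi_eq0 (coker_repr (coker_pi v) - v)).1.
  by rewrite raddfB /= coker_reprK subrr.
by exists (a *: u); rewrite linearZ /= fu.
Qed.

Let coker_ind (P : coker -> Prop) : (forall v, P (coker_pi v)) -> forall q, P q.
Proof. by move=> Ppi q; rewrite -[q]coker_reprK. Qed.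

Fact coker_scaleA a b q : coker_scale a (coker_scale b q) = coker_scale (a * b) q.
Proof. by elim/coker_ind: q => v; rewrite !coker_scale_pi scalerA. Qed.
Fact coker_scale1 : left_id 1 coker_scale.
Proof. by elim/coker_ind=> v; rewrite coker_scale_pi scale1r. Qed.
Fact coker_scaleDr : right_distributive coker_scale +%R.
Proof.
move=> a; elim/coker_ind=> v; elim/coker_ind=> w.
by rewrite -raddfD !coker_scale_pi scalerDr raddfD.
Qed.
Fact coker_scaleDl q : {morph coker_scale^~ q : a b / a + b}.
Proof. by elim/coker_ind: q => v a b; rewrite !coker_scale_pi scalerDl raddfD. Qed.

HB.instance Definition _ := GRing.Zmodule_isLmodule.Build A coker
  coker_scaleA coker_scale1 coker_scaleDr coker_scaleDl.

Lemma coker_piZ a v : coker_pi (a *: v) = a *: coker_pi v.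
Proof. by rewrite -coker_scale_pi. Qed.

End Cokernel.

Section SemidirectProduct.
Variables (gT : finGroupType) (M : lmodType (group_ring gT)).

(** Splittings of the projection from this group onto [gT] are the crossed
homomorphisms from [gT] to [M]. *)
Definition semidirect := (M * gT)%type.

HB.instance Definition _ := Choice.copy semidirect (M * gT)%type.

Implicit Types x y : semidirect.

Definition sd_mul x y : semidirect := (x.1 + gr_elt x.2 *: y.1, (x.2 * y.2)%g).
Definition sd_one : semidirect := (0, 1%g).
Definition sd_inv x : semidirect := (- (gr_elt x.2^-1%g *: x.1), x.2^-1%g).

Fact sd_mulA : associative sd_mul.
Proof.
move=> x y z; congr pair; last exact: mulgA.
by rewrite /= scalerDr scalerA gr_eltMr addrA.
Qed.
Fact sd_mul1 : left_id sd_one sd_mul.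
Proof. by move=> [m g]; rewrite /sd_mul /= add0r mul1g scale1r. Qed.
Fact sd_mulr1 : right_id sd_one sd_mul.
Proof. by move=> [m g]; rewrite /sd_mul /= scaler0 addr0 mulg1. Qed.
Fact sd_mulV : left_inverse sd_one sd_inv sd_mul.
Proof. by move=> [m g]; rewrite /sd_mul /= addNr mulVg. Qed.
Fact sd_mulrV : right_inverse sd_one sd_inv sd_mul.
Proof.
move=> [m g]; rewrite /sd_mul /= scalerN scalerA gr_eltMr mulgV.
by rewrite [gr_elt 1%g *: m]scale1r subrr.
Qed.

HB.instance Definition _ := isGroup.Build semidirect
  sd_mulA sd_mul1 sd_mulr1 sd_mulV sd_mulrV.

Lemma sd_mulE x y : (x * y)%g = (x.1 + gr_elt x.2 *: y.1, (x.2 * y.2)%g).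
Proof. by []. Qed.
End SemidirectProduct.

(** * Duality between rows and columns *)

Section Duality.
Variables (gT : finGroupType).
Local Notation A := (group_ring gT).

(** Given [d2 *m u = 0], the functional [x |-> coefficient of 1 in x u] is zero
on the image of [d2], so by hypothesis it only depends on [x *m d1], through the
additive map [s]; being represented by some [w] there, it forces [u = d1 w]. *)
Lemma dual_exact m n (d2 : 'M[A]_(m, n)) (d1 : 'cV[A]_n) (s : {additive A -> 'rV[A]_n}) :
    (forall x : 'rV_n, exists y, y *m d2 = x - s ((x *m d1) 0 0)) ->
  forall u : 'cV[A]_n, d2 *m u = 0 -> exists w : A, forall i, u i 0 = d1 i 0 * w.
Proof.
move=> sP u d2u; pose pair (x : 'rV[A]_n) := gr_coef 1%g ((x *m u) 0 0).
pose psi (y : A) := pair (s y).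
have psi_zmod : zmod_morphism psi.
  by move=> x y; rewrite /psi /pair raddfB /= mulmxBl !mxE raddfB.
pose psiM := GRing.isZmodMorphism.Build _ _ psi psi_zmod.
pose psiA : {additive A -> int} := HB.pack psi psiM.
have [w psi_w] := functional_coef psiA.
have pair_x x : pair x = gr_coef 1%g ((x *m d1) 0 0 * w).
  rewrite -psi_w /= /psi; have [y yd2] := sP x.
  apply/eqP; rewrite -subr_eq0 /pair -raddfB /=.
  have -> : (x *m u) 0 0 - (s ((x *m d1) 0 0) *m u) 0 0 = ((y *m d2) *m u) 0 0.
    by rewrite yd2 mulmxBl !mxE.
  by rewrite -mulmxA d2u mulmx0 mxE raddf0.
(* test against multiples of the basis vectors *)
exists w => i; apply/eqP; rewrite -subr_eq0; apply/eqP/gr_coef1_inj => y.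
have row_mul (v : 'cV[A]_n) : ((y *: delta_mx 0 i : 'rV_n) *m v) 0 0 = y * v i 0.
  by rewrite -scalemxAl -rowE !mxE.
have := pair_x (y *: delta_mx 0 i); rewrite /pair !row_mul => e.
by rewrite mulrBr raddfB /= e mulrA subrr.
Qed.
End Duality.

(** * The complex of an octahedral triple *)

Section RingIdentities.
Variables (A : nzRingType) (a b c : A).

(** The fundamental formula of Fox calculus for the relator [c b a = b]. *)
Lemma fox_relator : c * b * a = b ->
  c * b * (a - 1) + (c - 1) * (b - 1) + (c - 1) = 0.
Proof.
move=> cba; rewrite -addrA -{2}[c - 1]mulr1 -mulrDr subrK mulrBr mulr1 cba.
by rewrite mulrBl mul1r addrA subrK subrr.
Qed.

Lemma fox_relator_dual : a * c * b = c ->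
  (1 - a) * (c * b) + (1 - b) + (1 - c) * (b - 1) = 0.
Proof.
move=> acb; rewrite -addrA -(opprB b 1) addrC -[RHS]subr0.
have -> : - (b - 1) + (1 - c) * (b - 1) = c - c * b.
  by rewrite addrC mulrBl mul1r addrAC subrr sub0r mulrBr mulr1 opprB.
by rewrite mulrBl mul1r mulrA acb addrA subrK subrr subr0.
Qed.
End RingIdentities.

Section OctahedralComplex.
Variables (G : finGroupType) (a b c : G).
Hypothesis abc : octahedral_triple a b c.
Hypothesis gen : <<[set a; b; c]>>%g = [set: G].
Hypothesis card_G : #|{: G}| = 48%N.

Local Notation A := (group_ring G).
Local Notation "[ g ]" := (gr_elt g%g) (at level 0, g at level 99).

(** The boundary matrices for an arbitrary triple, the elements [omega] being
replaced by the products of generators that they are equal to. *)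
Definition bd1 : 'M[A]_(3, 1) := \col_(r < 3) [:: [a] - 1; [b] - 1; [c] - 1]`_r.

Definition bd2 : 'M[A]_(3, 3) :=
  \matrix_(r < 3, s < 3) (nth [::]
    [:: [:: [c * b]; [c] - 1; 1      ];
        [:: 1;       [a * c]; [a] - 1];
        [:: [b] - 1; 1;       [b * a]]] r)`_s.

Definition bd3 : 'M[A]_(1, 3) := \row_(s < 3) [:: 1 - [a]; 1 - [b]; 1 - [c]]`_s.

Definition bd4 : 'M[A]_(1, 1) := (\sum_(g : G) [g])%:M.

Lemma ord3P (P : 'I_3 -> Prop) : P 0 -> P 1 -> P 2%:R -> forall i, P i.
Proof.
move=> P0 P1 P2 [[|[|[|//]]] i3].
- by rewrite (_ : Ordinal i3 = 0) //; apply: val_inj.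
- by rewrite (_ : Ordinal i3 = 1) //; apply: val_inj.
- by rewrite (_ : Ordinal i3 = 2%:R) //; apply: val_inj.
Qed.

Lemma big_ord3 (V : zmodType) (F : 'I_3 -> V) : \sum_i F i = F 0 + F 1 + F 2%:R.
Proof.
rewrite !big_ord_recl big_ord0 addr0 addrA.
by congr (_ + F _ + F _); apply: val_inj.
Qed.

Lemma bd21 : bd2 *m bd1 = 0.
Proof.
have [cba acb bac] := abc.
apply/matrixP => r s; rewrite ord1 {s} mxE !big_ord_recl big_ord0 addr0 !mxE /=.
elim/ord3P: r => /=; rewrite ?mul1r -?gr_eltMr.
- by rewrite addrA fox_relator // !gr_eltMr cba.
- by rewrite addrC fox_relator // !gr_eltMr acb.
- by rewrite addrA addrC addrA fox_relator // !gr_eltMr bac.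
Qed.

Lemma bd32 : bd3 *m bd2 = 0.
Proof.
have [cba acb bac] := abc.
apply/matrixP => r s; rewrite ord1 {r} mxE !big_ord_recl big_ord0 addr0 !mxE /=.
elim/ord3P: s => /=; rewrite ?mulr1 -?gr_eltMr.
- by rewrite addrA fox_relator_dual // !gr_eltMr acb.
- by rewrite addrC fox_relator_dual // !gr_eltMr bac.
- by rewrite addrA addrC addrA fox_relator_dual // !gr_eltMr cba.
Qed.

Lemma aug_bd1 (x : A) :
  exists y : 'rV_3, (y *m bd1) 0 0 = x - (augmentation x)%:~R.
Proof.
elim/gr_ind: x => [g|x1 x2 [y1 e1] [y2 e2]]; last first.
  exists (y1 - y2); rewrite mulmxBl !mxE in e1 e2 *.
  by rewrite e1 e2 !raddfB addrACA.
rewrite augmentation_elt; move: g; apply: (generated_ind gen) => [|x|x y [u eu] [v ev]].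
- by exists 0; rewrite mul0mx mxE subrr.
- have delta i : ((delta_mx 0 i : 'rV_3) *m bd1) 0 0 = bd1 i 0 by rewrite -rowE mxE.
  rewrite !inE -orbA => /or3P[] /eqP->.
  + by exists (delta_mx 0 0); rewrite delta mxE.
  + by exists (delta_mx 0 1); rewrite delta mxE.
  + by exists (delta_mx 0 2%:R); rewrite delta mxE.
- exists (u + [x] *: v).
  rewrite mulmxDl -scalemxAl !mxE in eu ev *; rewrite eu ev.
  by rewrite mulrBr gr_eltMr mulr1 addrC addrA subrK.
Qed.

Lemma augmentation_bd1 (y : 'rV[A]_3) : augmentation ((y *m bd1) 0 0) = 0.
Proof.
rewrite mxE raddf_sum big1 // => i _; rewrite /= augmentationM mxE.
by elim/ord3P: i; rewrite raddfB /= augmentation_elt augmentation1 subrr mulr0.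
Qed.

Lemma exact_bd1 (x : 'rV[A]_1) :
  augmentation (x 0 0) = 0 <-> exists y : 'rV_3, y *m bd1 = x.
Proof.
split=> [x0|[y <-]]; last exact: augmentation_bd1.
have [y ey] := aug_bd1 (x 0 0); exists y.
by apply/rowP => i; rewrite !ord1 ey x0 subr0.
Qed.

Let pi := coker_pi (mulmxr bd2 : {linear 'rV[A]_3 -> 'rV[A]_3}).
Let M := coker (mulmxr bd2 : {linear 'rV[A]_3 -> 'rV[A]_3}).
Let e (i : 'I_3) : M := pi (delta_mx 0 i).

Let pi_sum (v : 'rV[A]_3) : pi v = \sum_i v 0 i *: e i.
Proof.
rewrite [in LHS](row_sum_delta v) /pi raddf_sum; apply: eq_bigr => i _.
exact: coker_piZ.
Qed.

(** The relations that define the cokernel [M]. *)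
Let pi_bd2 r : \sum_i bd2 r i *: e i = 0.
Proof.
have /coker_pi_eq0 : exists u, mulmxr bd2 u = row r bd2.
  by exists (delta_mx 0 r); rewrite /= -rowE.
rewrite -/pi pi_sum => row0; rewrite -[RHS]row0.
by apply: eq_bigr => i _; rewrite [row r _ _ _]mxE.
Qed.

(** The vanishing of row [i] of [bd2] in the cokernel is the first component of a
relator in the semidirect product, so the basis vectors paired with the
generators form an octahedral triple; splitting the projection gives [D]. On a
generator, [D] is the class of the matching basis vector, and the Fox product rule
extends this to all rows. *)
Lemma fox_retraction : exists D : G -> M, forall v : 'rV[A]_3,
  coker_pi (mulmxr bd2) v = gr_lift D ((v *m bd1) 0 0).
Proof.
have [cba acb bac] := abc.
pose ext i g : semidirect M := (e i, g).
have relator i j k x y z :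
    [z * y] *: e i + ([z] - 1) *: e j + e k = 0 -> (z * y * x)%g = y ->
  (ext k z * ext j y * ext i x)%g = ext j y.
  move=> r0 zyx; rewrite !sd_mulE /= zyx; congr pair; apply/eqP.
  rewrite -subr_eq0 -[X in _ == X]r0 scalerBl scale1r; apply/eqP.
  by rewrite [RHS]addrC -!addrA; congr (_ + _); rewrite addrCA.
have triple : octahedral_triple (ext 0 a) (ext 1 b) (ext 2%:R c).
  split.
  - apply: relator cba; rewrite -[RHS](pi_bd2 0) big_ord3 !mxE /=.
    by rewrite scale1r.
  - apply: relator acb; rewrite -[RHS](pi_bd2 1) big_ord3 !mxE /= scale1r.
    by rewrite addrC addrA.
  - apply: relator bac; rewrite -[RHS](pi_bd2 2%:R) big_ord3 !mxE /= scale1r.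
    by rewrite -addrA addrC.
have sndM : {morph (snd : semidirect M -> G) : x y / (x * y)%g} by [].
have [f [fM f2 [fa fb fc]]] := split_extension gen card_G sndM triple erefl erefl erefl.
pose D g := (f g).1.
have DM g h : D (g * h)%g = D g + [g] *: D h by rewrite /D fM sd_mulE /= f2.
have D1 : D 1%g = 0.
  by apply: (addrI (D 1%g)); rewrite addr0 -{3}[1%g]mul1g DM [_ *: _]scale1r.
exists D => v; rewrite -/pi pi_sum mxE raddf_sum; apply: eq_bigr => i _ /=.
have -> : gr_lift D (v 0 i * bd1 i 0) = v 0 i *: gr_lift D (bd1 i 0).
  rewrite (fox_product DM) (_ : augmentation _ = 0) ?addr0 // mxE.
  by elim/ord3P: i; rewrite raddfB /= augmentation_elt augmentation1 subrr.
have lift1 : gr_lift D 1 = 0 by rewrite -D1 -gr_lift_elt.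
rewrite mxE; congr (_ *: _).
by elim/ord3P: i; rewrite raddfB /= lift1 subr0 gr_lift_elt /D ?fa ?fb ?fc.
Qed.

Lemma exact_bd2 (x : 'rV[A]_3) : x *m bd1 = 0 <-> exists y : 'rV_3, y *m bd2 = x.
Proof.
split=> [xd1|[y <-]]; last by rewrite -mulmxA bd21 mulmx0.
have [D piD] := fox_retraction; have := piD x; rewrite xd1 mxE raddf0.
by move=> /coker_pi_eq0.
Qed.

(** Representatives of the values of [D] extend to an additive map [s] for which
[x] and [s (x *m bd1)] have the same class modulo the image of [bd2]. *)
Lemma exact_bd2_dual (u : 'cV[A]_3) :
  bd2 *m u = 0 -> exists w, forall i, u i 0 = bd1 i 0 * w.
Proof.
have [D piD] := fox_retraction.
pose s : {additive A -> 'rV[A]_3} := gr_lift (fun g => coker_repr (D g)).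
apply: (dual_exact (s := s)) => x.
suff /coker_pi_eq0 : coker_pi (mulmxr bd2) (x - s ((x *m bd1) 0 0)) = 0 by [].
rewrite raddfB /= gr_lift_comp piD; apply/eqP.
rewrite subr_eq0; apply/eqP/eq_bigr => g _ /=.
by rewrite coker_reprK.
Qed.

(** In the quaternions this is [(i - j) / sqrt 2]; conjugating by it after
inverting exchanges [tau_i] and [tau_j], and fixes [tau_k]. *)
Let r := (a * b * a * c * c)%g.

Let anti g h := (r * g^-1 = h * r)%g.

(** [a b a] conjugates [a] to [b], [b] to [a] and [c] to [c^-1], while [c ^+ 2]
inverts [a] and [b] and commutes with [c]. *)
Lemma reversing_tau : [/\ anti a b, anti b a & anti c c].
Proof.
have [_ _ bac] := abc; have cab := octahedral_triple_rot abc.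
have bca := octahedral_triple_rot cab; rewrite /anti /r.
have ab := octa_braid abc; have ca := octa_braid cab.
have bab : (b * a * b = a * b * a)%g by rewrite -[LHS]mulgA -[in LHS]ca [LHS]mulgA -ab.
have c2 x : (x * c ^+ 2 * x = c ^+ 2)%g -> (c * c * x^-1 = x * (c * c))%g.
  by move=> xcx; rewrite -expg2 -{1}xcx mulgK.
split; rewrite -(mulgA _ c c).
- rewrite -mulgA (c2 _ (octa_invert' cab)) !mulgA; congr (_ * _ * _)%g.
  by rewrite -[in LHS]bab -!mulgA.
- rewrite -mulgA (c2 _ (octa_invert bca)) !mulgA; congr (_ * _ * _)%g.
  by rewrite -!mulgA; congr (_ * _)%g; rewrite !mulgA bab.
- rewrite !mulgA mulgK; congr (_ * _)%g.
  by rewrite ca -(mulgA _ b a) -(mulgA _ _ c) bac.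
Qed.

Lemma reversing_mul g h g' h' : anti g g' -> anti h h' -> anti (g * h)%g (h' * g')%g.
Proof. by rewrite /anti => rg rh; rewrite invMg mulgA rh -mulgA rg mulgA. Qed.

Lemma reversing_elt g g' : anti g g' -> [r] * gr_star [g] = [g'] * [r].
Proof. by rewrite gr_star_elt !gr_eltMr => ->. Qed.

Let reversing_one : [r] * gr_star 1 = 1 * [r].
Proof. by rewrite (reversing_elt (g' := 1%g)) // /anti invg1 mulg1 mul1g. Qed.

Let reversing_sub g g' : anti g g' -> [r] * gr_star ([g] - 1) = ([g'] - 1) * [r].
Proof. by move=> gg'; rewrite raddfB mulrBr (reversing_elt gg') reversing_one -mulrBl. Qed.

Let s01 : {perm 'I_3} := tperm 0 1.

Let s01E : [/\ s01 0 = 1, s01 1 = 0 & s01 2%:R = 2%:R].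
Proof. by rewrite /s01 tpermL tpermR tpermD. Qed.

(** The anti-automorphism [x |-> r x^* r^-1] maps [bd2] to its transpose, up to
exchanging the indices 0 and 1. *)
Lemma bd2_anti i j : [r] * gr_star (bd2 i j) = bd2 (s01 j) (s01 i) * [r].
Proof.
have [ra rb rc] := reversing_tau; have [s0 s1 s2] := s01E.
elim/ord3P: i; elim/ord3P: j; rewrite ?s0 ?s1 ?s2 !mxE /=;
  by [exact: reversing_one | exact: reversing_sub
     | apply: reversing_elt; exact: reversing_mul].
Qed.

Lemma bd1_anti i : gr_star (bd1 (s01 i) 0) * [r] = - ([r] * bd3 0 i).
Proof.
have [ra rb rc] := reversing_tau; have [s0 s1 s2] := s01E.
have sub g g' : anti g g' -> gr_star ([g'] - 1) * [r] = - ([r] * (1 - [g])).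
  move=> rg; rewrite -mulrN opprB raddfB /= mulrBl mulrBr; congr (_ - _).
    rewrite gr_star_elt !gr_eltMr; congr gr_elt; apply: (mulgI g').
    by rewrite mulVKg mulgA -rg mulgVK.
  by rewrite gr_star_elt invg1 mulr1 [LHS]mul1r.
by elim/ord3P: i; rewrite ?s0 ?s1 ?s2 !mxE /=; exact: sub.
Qed.

(** The anti-automorphism turns a row killed by [bd2] into a column killed by
[bd2], which factors through [bd1]; going back, it factors through [bd3]. *)
Lemma exact_bd3 (x : 'rV[A]_3) : x *m bd2 = 0 <-> exists y : 'rV_1, y *m bd3 = x.
Proof.
split=> [xd2|[y <-]]; last by rewrite -mulmxA bd32 mulmx0.
have [w xw] : exists w, forall i, [r] * gr_star (x 0 (s01 i)) = bd1 i 0 * w.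
  have [|w uw] := @exact_bd2_dual (\col_i ([r] * gr_star (x 0 (s01 i)))).
    apply/colP => s; rewrite !mxE.
    have /rowP/(_ (s01 s)) := xd2; rewrite !mxE.
    move=> /(congr1 (fun z => [r] * gr_star z)); rewrite raddf0 mulr0 => xd2s; rewrite -[RHS]xd2s.
    rewrite raddf_sum mulr_sumr (reindex_inj (@perm_inj _ s01)) /=.
    apply: eq_bigr => i _; rewrite mxE gr_starM [RHS]mulrA bd2_anti -mulrA.
    by rewrite !tpermK.
  by exists w => i; rewrite -uw mxE.
exists (- (gr_star w * [r]))%:M; apply/rowP => i; rewrite mul_scalar_mx mxE.
rewrite mulNr -mulrA -mulrN -bd1_anti mulrA -gr_starM -xw /s01 tpermK.
by rewrite gr_starM gr_starK gr_star_elt -mulrA gr_eltMr mulVg [_ * _]mulr1.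
Qed.

Lemma gr_norm_coef g : gr_coef g (\sum_h [h] : A) = 1.
Proof.
rewrite raddf_sum (bigD1 g) //= gr_coef_elt eqxx big1 ?addr0 // => h /negPf hg.
by rewrite gr_coef_elt eq_sym hg.
Qed.

Lemma mul_gr_norm (x : A) : x * (\sum_h [h]) = (\sum_h [h]) *~ augmentation x.
Proof.
elim/gr_ind: x => [g|x1 x2 IH1 IH2]; last first.
  by rewrite mulrBl IH1 IH2 raddfB /= mulrzBr.
rewrite augmentation_elt mulr_sumr [RHS](reindex_inj (mulgI g)) /=.
by apply: eq_bigr => h _; rewrite gr_eltMr.
Qed.

Lemma gr_norm_mul g : (\sum_h [h]) * [g] = \sum_h [h] :> A.
Proof.
rewrite mulr_suml [RHS](reindex_inj (mulIg g)) /=.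
by apply: eq_bigr => h _; rewrite gr_eltMr.
Qed.

(** Right invariance makes all coefficients equal to the coefficient of 1. *)
Lemma gr_norm_invariant (x : A) :
  (forall g, x * [g] = x) -> x = (gr_coef 1%g x)%:~R * \sum_h [h].
Proof.
move=> xG; apply: gr_coef_inj => g.
rewrite mulrzl raddfMz /= gr_norm_coef intz -[in RHS](xG g^-1%g).
elim/gr_ind: {xG}x => [h|x1 x2 IH1 IH2]; last by rewrite mulrBl !raddfB /= IH1 IH2.
by rewrite gr_eltMr !gr_coef_elt [(1 == _)%g]eq_sym -eq_mulgV1 eq_sym.
Qed.

Lemma exact_bd4 (x : 'rV[A]_1) : x *m bd3 = 0 <-> exists y : 'rV_1, y *m bd4 = x.
Proof.
split=> [xd3|[y <-]]; last first.
  apply/rowP => i; rewrite -mulmxA [X in _ *m X](_ : _ = 0) ?mulmx0 //.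
  apply/rowP => s; rewrite mul_scalar_mx !mxE.
  by elim/ord3P: s; rewrite mulrBr mulr1 gr_norm_mul subrr.
have x1 s : x 0 0 * bd3 0 s = 0.
  by have /rowP/(_ s) := xd3; rewrite mxE big_ord1 [in RHS]mxE.
have xG : forall g, x 0 0 * [g] = x 0 0.
  apply: (generated_ind gen) => [|g|g h xg xh].
  - exact: mulr1.
  - rewrite !inE -orbA => /or3P[] /eqP->; apply/eqP; rewrite eq_sym -subr_eq0.
    + by have := x1 0; rewrite mxE /= mulrBr mulr1 => ->.
    + by have := x1 1; rewrite mxE /= mulrBr mulr1 => ->.
    + by have := x1 2%:R; rewrite mxE /= mulrBr mulr1 => ->.
  - by rewrite -gr_eltMr mulrA xg.
exists (gr_coef 1%g (x 0 0))%:~R%:M; apply/rowP => i.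
by rewrite mul_scalar_mx !mxE !ord1 -gr_norm_invariant.
Qed.

(** Multiplication by the norm has the augmentation ideal as its kernel, since
the norm has infinite additive order. *)
Lemma exact_bd5 (x : 'rV[A]_1) : x *m bd4 = 0 <-> exists y : 'rV_3, y *m bd1 = x.
Proof.
rewrite -exact_bd1.
have -> : x *m bd4 = ((\sum_h [h]) *~ augmentation (x 0 0))%:M.
  apply/rowP => i; rewrite !ord1 mxE big_ord1 !mxE eqxx !mulr1n.
  exact: mul_gr_norm.
split=> [/rowP/(_ 0)|->]; last by rewrite mulr0z raddf0.
rewrite !mxE eqxx mulr1n => /(congr1 (gr_coef 1%g)).
by rewrite raddf0 raddfMz /= gr_norm_coef intz.
Qed.

End OctahedralComplex.

(** * The resolution *)

Lemma free_row (A : nzRingType) n : free_of_finite_rank 'rV[A]_n.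
Proof.
exists n, (delta_mx 0) => v; exists v; split=> [|w ->]; first exact: row_sum_delta.
by rewrite -row_sum_delta.
Qed.

Section OctahedralResolution.
Variable R : realType.

Lemma octa_bd2E : octa_bd2 R = bd2 (tau_i R) (tau_j R) (tau_k R).
Proof. by have [oi oj ok] := omegaE R; rewrite /octa_bd2 oi oj ok. Qed.

Lemma octa_exact0 (x : octa_term R 0) :
  octa_augmentation R x = 0 <-> exists y, octa_diff R 0 y = x.
Proof. exact: exact_bd1 (tau_generate R) x. Qed.

Lemma octa_exact m (x : octa_term R m.+1) :
  octa_diff R m x = 0 <-> exists y, octa_diff R m.+1 y = x.
Proof.
pose t := tau_triple R; pose g := tau_generate R; pose n := card_octa R.
(* the matrices in degrees [m.+4] and [m] are convertible *)
move: m x; fix IH 1 => -[|[|[|[|m]]]] x; last exact: IH m x.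
- rewrite /octa_diff /= octa_bd2E; exact: (exact_bd2 t g n x).
- rewrite /octa_diff /= octa_bd2E; exact: (exact_bd3 t g n x).
- exact: (exact_bd4 g x).
- exact: (exact_bd5 g x).
Qed.
End OctahedralResolution.

Theorem corollary4p3p2 (R : realType) :
  [/\ free_resolution (@octa_diff R) (octa_augmentation R),
      forall m : nat, octa_rank m.+4 = octa_rank m
    & forall m : nat, octa_bd R m.+4 = octa_bd R m].
Proof.
split=> //; split.
- move=> m; exact: free_row.
- move=> z; exists (const_mx (gr_elt 1%g *~ z)).
  rewrite /= /row_augmentation mxE raddfMz /= augmentation_elt; exact: intz.
- exact: octa_exact0.
- exact: octa_exact.
Qed.
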